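(* Let $(a_\nu)_{\nu\in\mathbb{Z}_{\ge 0}^3}$ be a family of quaternions and let $$\sigma=\limsup_{n\to\infty}\Bigl(\sum_{\substack{\nu=(n_1,n_2,n_3)\\ n_1+n_2+n_3=n}}\binom{n}{n_1,n_2,n_3}\frac{\|a_\nu\|}{n!}\Bigr)^{1/n}.$$ Then the series $$f(x)=\sum_{n=0}^\infty\ \sum_{\substack{\nu=(n_1,n_2,n_3)\\ n_1+n_2+n_3=n}} P_\nu(x)\, a_\nu$$ converges compactly on $B'(0,\tfrac1\sigma)$.
   Context: $\mathbb{H}=\{x_0+ix_1+jx_2+kx_3 : x_0,x_1,x_2,x_3\in\mathbb{R}\}$ denotes the quaternions ($i^2=j^2=k^2=ijk=-1$), with Euclidean norm $\|\cdot\|$. For $x=x_0+ix_1+jx_2+kx_3$, the Fueter basis is $\zeta_1(x)=x_1-ix_0$, $\zeta_2(x)=x_2-jx_0$, $\zeta_3(x)=x_3-kx_0$. For a multi-index $\nu=(n_1,n_2,n_3)\in\mathbb{Z}_{\ge0}^3$ with $n=n_1+n_2+n_3$, let $A_\nu$ be the set of all words $(i_1,\dots,i_n)$ of length $n$ with exactly $n_1$ letters $1$, $n_2$ letters $2$ and $n_3$ letters $3$, and define $$P_\nu(x)=\frac{1}{n!}\sum_{(i_1,\dots,i_n)\in A_\nu}\zeta_{i_1}(x)\cdots\zeta_{i_n}(x)$$ (the product over the empty word is $1$). $\binom{n}{n_1,n_2,n_3}=\frac{n!}{n_1!n_2!n_3!}$. The auxiliary norm is $\|x_0+ix_1+jx_2+kx_3\|'=\max\{\sqrt{x_0^2+x_1^2},\sqrt{x_0^2+x_2^2},\sqrt{x_0^2+x_3^2}\}$,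 and $B'(0,r)=\{x\in\mathbb{H}:\|x\|'<r\}$. Conventions: if $\sigma=0$ then $1/\sigma=\infty$ and $B'(0,\infty)=\mathbb{H}$; if $\sigma=\infty$ then $1/\sigma=0$ and $B'(0,0)=\emptyset$. A series $\sum_{n}\sum_{\|\nu\|=n}P_\nu a_\nu$ (where $\|\nu\|=n_1+n_2+n_3$) converges compactly on an open set if its partial sums over $n\le N$ converge, as $N\to\infty$, uniformly on every compact subset of that set. *)

(* Defs.v *)
From HB Require Import structures.
From mathcomp Require Import all_boot all_order all_algebra.
From mathcomp Require Import ring lra.
From mathcomp Require Import all_classical all_reals all_analysis.

Set Implicit Arguments.
Unset Strict Implicit.
Unset Printing Implicit Defensive.

Import Order.TTheory GRing.Theory Num.Theory.
Import numFieldNormedType.Exports.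

Local Open Scope classical_set_scope.
Local Open Scope ring_scope.

(* [Quat x0 x1 x2 x3] is the quaternion x0 + i x1 + j x2 + k x3. *)
Record quat (R : realType) := Quat { q0 : R; q1 : R; q2 : R; q3 : R }.

Section QuatAlgebra.
Variable R : realType.
Implicit Types (x y z : quat R) (c : R).

Definition quat_to_prod x : R * R * R * R := (q0 x, q1 x, q2 x, q3 x).
Definition quat_of_prod (u : R * R * R * R) : quat R :=
  Quat u.1.1.1 u.1.1.2 u.1.2 u.2.

Lemma quat_to_prodK : cancel quat_to_prod quat_of_prod.
Proof. by case. Qed.

HB.instance Definition _ := Choice.copy (quat R) (can_type quat_to_prodK).

Definition quat_add x y :=
  Quat (q0 x + q0 y) (q1 x + q1 y) (q2 x + q2 y) (q3 x + q3 y).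
Definition quat_opp x := Quat (- q0 x) (- q1 x) (- q2 x) (- q3 x).

Lemma quat_addA : associative quat_add.
Proof. by move=> x y z; rewrite /quat_add /= !addrA. Qed.
Lemma quat_addC : commutative quat_add.
Proof. by move=> x y; congr Quat; rewrite addrC. Qed.
Lemma quat_add0 : left_id (Quat 0 0 0 0) quat_add.
Proof. by case=> *; rewrite /quat_add /= !add0r. Qed.
Lemma quat_addN : left_inverse (Quat 0 0 0 0) quat_opp quat_add.
Proof. by case=> *; rewrite /quat_add /= !addNr. Qed.

HB.instance Definition _ := GRing.isZmodule.Build (quat R)
  quat_addA quat_addC quat_add0 quat_addN.

Definition quat_mul x y := Quat
  (q0 x * q0 y - q1 x * q1 y - q2 x * q2 y - q3 x * q3 y)
  (q0 x * q1 y + q1 x * q0 y + q2 x * q3 y - q3 x * q2 y)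
  (q0 x * q2 y - q1 x * q3 y + q2 x * q0 y + q3 x * q1 y)
  (q0 x * q3 y + q1 x * q2 y - q2 x * q1 y + q3 x * q0 y).

Lemma quat_mulA : associative quat_mul.
Proof. by move=> x y z; congr Quat => /=; ring. Qed.
Lemma quat_mul1r : left_id (Quat 1 0 0 0) quat_mul.
Proof. by case=> *; congr Quat => /=; ring. Qed.
Lemma quat_mulr1 : right_id (Quat 1 0 0 0) quat_mul.
Proof. by case=> *; congr Quat => /=; ring. Qed.
Lemma quat_mulDl : left_distributive quat_mul +%R.
Proof. by move=> x y z; congr Quat => /=; ring. Qed.
Lemma quat_mulDr : right_distributive quat_mul +%R.
Proof. by move=> x y z; congr Quat => /=; ring. Qed.
Lemma quat_oner_neq0 : Quat 1 0 0 0 != 0 :> quat R.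
Proof. by apply/eqP => -[/eqP]; rewrite oner_eq0. Qed.

HB.instance Definition _ := GRing.Zmodule_isNzRing.Build (quat R)
  quat_mulA quat_mul1r quat_mulr1 quat_mulDl quat_mulDr quat_oner_neq0.

Definition quat_scale c x := Quat (c * q0 x) (c * q1 x) (c * q2 x) (c * q3 x).

Lemma quat_scaleA a b x : quat_scale a (quat_scale b x) = quat_scale (a * b) x.
Proof. by congr Quat => /=; ring. Qed.
Lemma quat_scale1 : left_id 1 quat_scale.
Proof. by case=> *; congr Quat => /=; ring. Qed.
Lemma quat_scaleDr : right_distributive quat_scale +%R.
Proof. by move=> c x y; congr Quat => /=; ring. Qed.
Lemma quat_scaleDl x : {morph quat_scale^~ x : a b / a + b}.
Proof. by move=> a b; congr Quat => /=; ring. Qed.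

HB.instance Definition _ := GRing.Zmodule_isLmodule.Build R (quat R)
  quat_scaleA quat_scale1 quat_scaleDr quat_scaleDl.

Lemma quat_scaleAl c x y : c *: (x * y) = (c *: x) * y.
Proof. by congr Quat => /=; ring. Qed.

HB.instance Definition _ :=
  GRing.Lmodule_isLalgebra.Build R (quat R) quat_scaleAl.

Lemma quat_scaleAr c x y : c *: (x * y) = x * (c *: y).
Proof. by congr Quat => /=; ring. Qed.

HB.instance Definition _ :=
  GRing.Lalgebra_isAlgebra.Build R (quat R) quat_scaleAr.

Definition quat_norm x : R :=
  Num.sqrt (q0 x ^+ 2 + q1 x ^+ 2 + q2 x ^+ 2 + q3 x ^+ 2).

Lemma quat_normD x y : quat_norm (x + y) <= quat_norm x + quat_norm y.
Proof.
rewrite /quat_norm /=.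
set s := (X in Num.sqrt X <= _); set a := (X in Num.sqrt X + _).
set b := (X in _ + Num.sqrt X).
have a0 : 0 <= a by rewrite !addr_ge0 ?sqr_ge0.
have b0 : 0 <= b by rewrite !addr_ge0 ?sqr_ge0.
set d := q0 x * q0 y + q1 x * q1 y + q2 x * q2 y + q3 x * q3 y.
have sE : s = a + b + d *+ 2 by rewrite /s /a /b /d; ring.
have dab : d <= Num.sqrt a * Num.sqrt b.
  rewrite -sqrtrM //; apply: le_trans (ler_norm d) _.
  rewrite -sqrtr_sqr; apply: ler_wsqrtr; rewrite -subr_ge0.
  suff -> : a * b - d ^+ 2 =
      (q0 x * q1 y - q1 x * q0 y) ^+ 2 + (q0 x * q2 y - q2 x * q0 y) ^+ 2
    + (q0 x * q3 y - q3 x * q0 y) ^+ 2 + (q1 x * q2 y - q2 x * q1 y) ^+ 2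
    + (q1 x * q3 y - q3 x * q1 y) ^+ 2 + (q2 x * q3 y - q3 x * q2 y) ^+ 2.
    by rewrite !addr_ge0 ?sqr_ge0.
  by rewrite /a /b /d; ring.
have ab0 : 0 <= Num.sqrt a + Num.sqrt b by rewrite addr_ge0 ?sqrtr_ge0.
rewrite -[leRHS](ger0_norm ab0) -sqrtr_sqr; apply: ler_wsqrtr.
by rewrite sqrrD !sqr_sqrtr // sE addrAC lerD2r lerD2l lerMn2r.
Qed.

Lemma quat_normZ c x : quat_norm (c *: x) = `|c| * quat_norm x.
Proof.
rewrite /quat_norm -sqrtr_sqr -sqrtrM ?sqr_ge0 //; congr Num.sqrt => /=.
ring.
Qed.

Lemma quat_norm0_eq0 x : quat_norm x = 0 -> x = 0.
Proof.
move/eqP; rewrite sqrtr_eq0 => h.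
have := sqr_ge0 (q0 x); have := sqr_ge0 (q1 x).
have := sqr_ge0 (q2 x); have := sqr_ge0 (q3 x) => h3 h2 h1 h0.
case: x h h0 h1 h2 h3 => a b c d /= h h0 h1 h2 h3.
by congr Quat; apply/eqP; rewrite -sqrf_eq0; apply/eqP; lra.
Qed.

(* The norm [`|x|] of [quat R] is the Euclidean one; the topology and the
   uniform structure are those it induces. *)
HB.instance Definition _ := Lmodule_isNormed.Build R (quat R)
  quat_normD quat_normZ quat_norm0_eq0.

End QuatAlgebra.

Section FueterSeries.
Variable R : realType.
Implicit Types (x : quat R) (a : nat -> nat -> nat -> quat R).

Definition qi : quat R := Quat 0 1 0 0.
Definition qj : quat R := Quat 0 0 1 0.
Definition qk : quat R := Quat 0 0 0 1.

(* Letters are numbered 0, 1, 2 instead of 1, 2, 3. *)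
Definition zeta (l : 'I_3) x : quat R :=
  tnth [tuple (q1 x)%:A - qi * (q0 x)%:A;
              (q2 x)%:A - qj * (q0 x)%:A;
              (q3 x)%:A - qk * (q0 x)%:A] l.

Definition fueter_words (n1 n2 n3 : nat) :
    {set (n1 + n2 + n3).-tuple 'I_3} :=
  [set w : (n1 + n2 + n3).-tuple 'I_3 |
     [&& count_mem 0 w == n1,
         count_mem 1 w == n2 &
         count_mem 2 w == n3]]%SET.

Definition fueter_poly (n1 n2 n3 : nat) x : quat R :=
  ((n1 + n2 + n3)`!%:R)^-1 *:
    \sum_(w in fueter_words n1 n2 n3) \prod_(l <- w) zeta l x.

Definition multinom3 (n1 n2 n3 : nat) : R :=
  (n1 + n2 + n3)`!%:R / (n1`!%:R * n2`!%:R * n3`!%:R).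

Definition fueter_term a (n : nat) x : quat R :=
  \sum_(n1 < n.+1) \sum_(n2 < n.+1) \sum_(n3 < n.+1 | (n1 + n2 + n3 == n)%N)
    fueter_poly n1 n2 n3 x * a n1 n2 n3.

Definition fueter_psum a (N : nat) x : quat R :=
  \sum_(n < N.+1) fueter_term a n x.

(* At n = 0 the exponent is 0^-1 = 0, which does not affect the limsup. *)
Definition fueter_sigma a : \bar R :=
  limn_esup (fun n : nat =>
    ((\sum_(n1 < n.+1) \sum_(n2 < n.+1)
        \sum_(n3 < n.+1 | (n1 + n2 + n3 == n)%N)
        multinom3 n1 n2 n3 * (`|a n1 n2 n3| / n`!%:R)) `^ (n%:R^-1))%:E).

Definition norm' x : R :=
  Num.max (Num.sqrt (q0 x ^+ 2 + q1 x ^+ 2))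
    (Num.max (Num.sqrt (q0 x ^+ 2 + q2 x ^+ 2))
             (Num.sqrt (q0 x ^+ 2 + q3 x ^+ 2))).

Definition ball' (r : \bar R) : set (quat R) := [set x | ((norm' x)%:E < r)%E].

Definition converges_compactly (S : nat -> quat R -> quat R)
    (U : set (quat R)) : Prop :=
  exists f : quat R -> quat R,
    forall K : set (quat R), compact K -> K `<=` U -> {uniform K, S @ \oo --> f}.

End FueterSeries.

(* Main.v *)
(* Each zeta_l has norm at most norm' and the quaternion norm is multiplicative,
   so |P_nu| is at most #A_nu / n! * norm' ^ n, where #A_nu is at most the
   multinomial coefficient.  The n-th block of the series is thus bounded by
   c_n * norm' ^ n with sigma = limsup c_n ^ (1/n).  On a compact subset of
   B'(0, 1/sigma) the function norm' attains a maximum r < t < 1/sigma;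
   eventually c_n <= t ^ (- n), and the series is dominated by the geometric
   series of ratio r / t. *)
Require Import Defs.
From mathcomp Require Import all_boot all_order all_algebra.
From mathcomp Require Import all_classical all_reals all_analysis.
From mathcomp Require Import ring lra zify.

Set Implicit Arguments.
Unset Strict Implicit.
Unset Printing Implicit Defensive.

Import Order.TTheory GRing.Theory Num.Theory.
Import numFieldNormedType.Exports.

Local Open Scope classical_set_scope.
Local Open Scope ring_scope.

(** * Multiplicativity of the norm, continuity of [norm'], bounds on products of [zeta] *)

Section QuatNorm.
Variable R : realType.
Implicit Types (x y : quat R).

Lemma quat_normE x :
  `|x| = Num.sqrt (q0 x ^+ 2 + q1 x ^+ 2 + q2 x ^+ 2 + q3 x ^+ 2).
Proof. by []. Qed.

(** Under the square root this is Euler's four-square identity, which [ring] checks. *)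
Lemma quat_normM x y : `|x * y| = `|x| * `|y|.
Proof.
rewrite !quat_normE -sqrtrM ?addr_ge0 ?sqr_ge0 //; congr Num.sqrt => /=.
ring.
Qed.

Lemma quat_norm1 : `|1 : quat R| = 1.
Proof. by rewrite quat_normE /= expr1n !expr0n /= !addr0 sqrtr1. Qed.

Lemma normr_le_sqrt (a b : R) : a ^+ 2 <= b -> `|a| <= Num.sqrt b.
Proof. by move=> ab; rewrite -sqrtr_sqr ler_wsqrtr. Qed.

Lemma quat_coord_le x :
  [/\ `|q0 x| <= `|x|, `|q1 x| <= `|x|, `|q2 x| <= `|x| & `|q3 x| <= `|x|].
Proof.
have := sqr_ge0 (q0 x); have := sqr_ge0 (q1 x).
have := sqr_ge0 (q2 x); have := sqr_ge0 (q3 x) => h3 h2 h1 h0.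
by rewrite quat_normE; split; apply: normr_le_sqrt; lra.
Qed.

Lemma quat_norm_le x : `|x| <= `|q0 x| + `|q1 x| + `|q2 x| + `|q3 x|.
Proof.
rewrite quat_normE -[leRHS]ger0_norm ?addr_ge0 // -sqrtr_sqr ler_wsqrtr //.
rewrite -![_ x ^+ 2]real_normK ?num_real //.
have := normr_ge0 (q0 x); have := normr_ge0 (q1 x).
have := normr_ge0 (q2 x); have := normr_ge0 (q3 x).
nra.
Qed.

(** The two hypotheses make [p] 1-Lipschitz; the coordinates are the intended instances. *)
Lemma quat_coord_continuous (p : quat R -> R) :
  (forall x y, p (x - y) = p x - p y) -> (forall x, `|p x| <= `|x|) ->
  continuous p.
Proof.
move=> pB p_le x; apply/(@cvgrPdist_lt _ _ _ _ (nbhs_filter x)) => e e0.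
apply: filterS (nbhsx_ballx x e e0) => y; rewrite -ball_normE /=.
by rewrite -pB; exact: le_lt_trans (p_le _).
Qed.

Lemma norm'_continuous : continuous (@norm' R).
Proof.
have c0 := @quat_coord_continuous (@q0 R) (fun _ _ => erefl)
  (fun x => let: And4 h0 h1 h2 h3 := quat_coord_le x in h0).
have c1 := @quat_coord_continuous (@q1 R) (fun _ _ => erefl)
  (fun x => let: And4 h0 h1 h2 h3 := quat_coord_le x in h1).
have c2 := @quat_coord_continuous (@q2 R) (fun _ _ => erefl)
  (fun x => let: And4 h0 h1 h2 h3 := quat_coord_le x in h2).
have c3 := @quat_coord_continuous (@q3 R) (fun _ _ => erefl)
  (fun x => let: And4 h0 h1 h2 h3 := quat_coord_le x in h3).
have cs (p : quat R -> R) : continuous p ->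
    continuous (fun x => Num.sqrt (q0 x ^+ 2 + p x ^+ 2)).
  move=> cp x; apply: continuous_comp; last exact: sqrt_continuous.
  have sq (f : quat R -> R) : continuous f -> {for x, continuous (fun y => f y ^+ 2)}.
    move=> cf; have := @continuous_comp (quat R) R R f (fun u => u ^+ 2) x (cf x).
    by apply; exact: exprn_continuous.
  by apply: (@continuousD R R (quat R)); exact: sq.
move=> x; apply: (@continuous_max R (quat R)); first exact: cs.
by apply: (@continuous_max R (quat R)); exact: cs.
Qed.

Lemma norm'_ge0 x : 0 <= norm' x.
Proof. by rewrite /norm' le_max sqrtr_ge0. Qed.

(** Only two coordinates of [zeta l x] can be nonzero, so its norm is exactly one of the three roots
    in the maximum. *)
Lemma zeta_norm_le (l : 'I_3) x : `|zeta l x| <= norm' x.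
Proof.
rewrite /zeta /norm' !le_max quat_normE.
have le (u v : R) : u = v -> Num.sqrt u <= Num.sqrt v by move=> ->.
case: l => -[|[|[|//]]] lt; rewrite /tnth /=.
- by rewrite le //; ring.
- by rewrite (le _ (q0 x ^+ 2 + q2 x ^+ 2)) ?orbT //; ring.
- by rewrite (le _ (q0 x ^+ 2 + q3 x ^+ 2)) ?orbT //; ring.
Qed.

Lemma word_norm_le (w : seq 'I_3) x :
  `|\prod_(l <- w) zeta l x| <= norm' x ^+ size w.
Proof.
elim: w => [|l w IH]; first by rewrite big_nil quat_norm1.
by rewrite big_cons quat_normM exprS ler_pM // zeta_norm_le.
Qed.

End QuatNorm.

(** * Counting words with prescribed letter counts *)

Section Words.

(** The length is a separate parameter, so that induction on it leaves the tuple type free of the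
    letter counts. *)
Definition words n n1 n2 n3 : {set n.-tuple 'I_3} :=
  [set w : n.-tuple 'I_3 |
     [&& count_mem (0 : 'I_3) w == n1, count_mem (1 : 'I_3) w == n2
       & count_mem (2 : 'I_3) w == n3]]%SET.

(** Every word is its head put before its tail, so three images of sets of tails cover [A]; the
    union bound suffices. *)
Lemma card_words_cons n (A : {set n.+1.-tuple 'I_3}) :
  (#|A| <= \sum_(l < 3) #|[set w : n.-tuple 'I_3 | [tuple of l :: w] \in A]%SET|)%N.
Proof.
pose B l := [set w : n.-tuple 'I_3 | [tuple of l :: w] \in A]%SET.
pose C l := [set [tuple of l :: w] | w : n.-tuple 'I_3 in B l]%SET.
have AC : A \subset (\bigcup_l C l)%SET.
  apply/fintype.subsetP => w wA; apply/finset.bigcupP; exists (thead w) => //.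
  by apply/imsetP; exists (behead_tuple w); rewrite ?inE -tuple_eta.
apply: leq_trans (subset_leq_card AC) _.
elim/big_ind2 : _ => [|S m T k Sm Tk|l _]; first by rewrite cards0.
  by apply: leq_trans (leq_card_setU _ _) _; rewrite leq_add.
exact: leq_imset_card.
Qed.

(** Induction by deleting the first letter, which lowers one count by one; denominators are cleared
    to stay in [nat]. *)
Lemma card_words_le n n1 n2 n3 : n = (n1 + n2 + n3)%N ->
  (#|words n n1 n2 n3| * (n1`! * n2`! * n3`!) <= n`!)%N.
Proof.
elim: n n1 n2 n3 => [|n IH] n1 n2 n3 nE.
  have [-> -> ->] : [/\ n1 = 0, n2 = 0 & n3 = 0]%N by split; lia.
  by rewrite !muln1 (leq_trans (max_card _)) // card_tuple expn0.
have scale (B W P F k : nat) : (W * P <= F -> B <= W -> B * (k * P) <= k * F)%N.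
  move=> WP BW; rewrite mulnCA leq_mul2l (leq_trans _ WP) ?orbT //.
  by rewrite leq_mul2r BW orbT.
have := card_words_cons (words n.+1 n1 n2 n3).
rewrite !big_ord_recl big_ord0 addn0 addnA.
set B1 := (X in (_ <= X + _ + _)%N); set B2 := (X in (_ <= _ + X + _)%N).
set B3 := (X in (_ <= _ + X)%N) => AB.
(* No word starts with a letter of count zero; otherwise one factor leaves that letter's factorial
   and the induction hypothesis bounds the tails. *)
have b1 : (B1 * (n1`! * n2`! * n3`!) <= n1 * n`!)%N.
  case: n1 nE @B1 @B2 @B3 {AB} => [|m] nE B1 B2 B3.
    by rewrite /B1 eq_card0 // => w; rewrite !inE.
  have : (B1 <= #|words n m n2 n3|)%N.
    by apply/subset_leq_card/fintype.subsetP => w; rewrite !inE.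
  have -> : (m.+1`! * n2`! * n3`! = m.+1 * (m`! * n2`! * n3`!))%N.
    by rewrite factS; ring.
  by apply: scale; apply: IH; lia.
have b2 : (B2 * (n1`! * n2`! * n3`!) <= n2 * n`!)%N.
  case: n2 nE @B1 @B2 @B3 {AB b1} => [|m] nE B1 B2 B3.
    by rewrite /B2 eq_card0 // => w; rewrite !inE /= andbF.
  have : (B2 <= #|words n n1 m n3|)%N.
    by apply/subset_leq_card/fintype.subsetP => w; rewrite !inE.
  have -> : (n1`! * m.+1`! * n3`! = m.+1 * (n1`! * m`! * n3`!))%N.
    by rewrite factS; ring.
  by apply: scale; apply: IH; lia.
have b3 : (B3 * (n1`! * n2`! * n3`!) <= n3 * n`!)%N.
  case: n3 nE @B1 @B2 @B3 {AB b1 b2} => [|m] nE B1 B2 B3.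
    by rewrite /B3 eq_card0 // => w; rewrite !inE /= !andbF.
  have : (B3 <= #|words n n1 n2 m|)%N.
    by apply/subset_leq_card/fintype.subsetP => w; rewrite !inE.
  have -> : (n1`! * n2`! * m.+1`! = m.+1 * (n1`! * n2`! * m`!))%N.
    by rewrite factS; ring.
  by apply: scale; apply: IH; lia.
(* The three bounds add up to [(n1 + n2 + n3) * n!], that is [(n + 1)!]. *)
apply: leq_trans (leq_mul AB (leqnn _)) _.
by rewrite factS nE !mulnDl !leq_add.
Qed.

End Words.

(** * Uniform limits from a Cauchy estimate with explicit rate *)

Section UniformCauchy.
Variable R : realType.

Lemma cauchy_rate_lim (u e : R^nat) (N : nat) : e n @[n --> \oo] --> 0 ->
  (forall n m, (N <= n <= m)%N -> `|u m - u n| <= e n) ->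
  forall n, (N <= n)%N -> `|limn u - u n| <= e n.
Proof.
move=> e0 ue n Nn.
have cu : cvgn u.
  apply/cauchy_cvgP; apply: cauchy_exP => eps eps0.
  have [M _ eM] : \forall n \near \oo, `|e n| < eps.
    by apply/cvgr0_norm_lt.
  exists (u (maxn N M)); exists (maxn N M) => // m /= Mm.
  rewrite -ball_normE /= distrC; apply: le_lt_trans (ue _ _ _) _.
    by rewrite leq_maxl.
  by apply: le_lt_trans (ler_norm _) _; apply: eM; rewrite /= leq_maxr.
(* With [n] fixed, the bound [e n] survives the limit in [m]. *)
have cun : `|u m - u n| @[m --> \oo] --> `|limn u - u n|.
  by apply: cvg_norm; apply: cvgB => //; exact: cvg_cst.
rewrite -(cvg_lim _ cun) //; apply: limr_le; first by apply/cvg_ex; eexists; exact: cun.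
by exists n => // m /= nm; apply: ue; rewrite Nn.
Qed.

(** Taken coordinatewise, so that completeness of [R] is enough. *)
Definition quat_lim (u : nat -> quat R) : quat R :=
  Quat (limn (q0 (R:=R) \o u)) (limn (q1 (R:=R) \o u))
       (limn (q2 (R:=R) \o u)) (limn (q3 (R:=R) \o u)).

(** The factor 4 comes from bounding the norm by the sum of four coordinates. *)
Lemma quat_cauchy_rate_lim (u : nat -> quat R) (e : R^nat) (N : nat) :
  e n @[n --> \oo] --> 0 ->
  (forall n m, (N <= n <= m)%N -> `|u m - u n| <= e n) ->
  forall n, (N <= n)%N -> `|quat_lim u - u n| <= e n *+ 4.
Proof.
move=> e0 ue n Nn.
have coord (p : quat R -> R) : (forall x y, p (x - y) = p x - p y) ->
    (forall x, `|p x| <= `|x|) -> `|limn (p \o u) - p (u n)| <= e n.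
  move=> pB p_le; apply: (cauchy_rate_lim (N := N)) => // k m km /=.
  by rewrite -pB; apply: le_trans (p_le _) (ue _ _ km).
apply: le_trans (quat_norm_le _) _; rewrite !mulrS addr0 !addrA /=.
by rewrite !lerD // coord // => x; case: (quat_coord_le x).
Qed.

Lemma uniform_cauchy_rate_lim (S : nat -> quat R -> quat R) (K : set (quat R))
    (e : R^nat) (N : nat) :
  e n @[n --> \oo] --> 0 ->
  (forall x n m, K x -> (N <= n <= m)%N -> `|S m x - S n x| <= e n) ->
  {uniform K, S @ \oo --> fun x => quat_lim (S^~ x)}.
Proof.
move=> e0 Se P /uniform_nbhs[E [entE EP]].
move: entE; rewrite -entourage_from_ballE => -[eps /= eps0 epsE].
have [M _ eM] : \forall n \near \oo, `|e n *+ 4| < eps.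
  apply/cvgr0_norm_lt => //; rewrite -(mul0rn _ 4).
  exact: cvgMn.
exists (maxn N M) => // n /=; rewrite geq_max => /andP[Nn Mn].
apply: EP => x Kx; apply: epsE => /=; rewrite -ball_normE /=.
apply: le_lt_trans (quat_cauchy_rate_lim e0 (fun k m => Se x k m Kx) Nn) _.
exact: le_lt_trans (ler_norm _) (eM n Mn).
Qed.

End UniformCauchy.

(** * Bounds on the blocks of the series and on its partial sums *)

Section FueterSeries.
Variable R : realType.
Implicit Types (a : nat -> nat -> nat -> quat R) (x : quat R).

Lemma card_fueter_words_le n1 n2 n3 :
  #|fueter_words n1 n2 n3|%:R <= multinom3 R n1 n2 n3.
Proof.
rewrite /multinom3 ler_pdivlMr ?mulr_gt0 ?ltr0n ?fact_gt0 //.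
by rewrite -!natrM ler_nat; exact: card_words_le.
Qed.

Lemma fueter_poly_norm_le n1 n2 n3 x :
  `|fueter_poly n1 n2 n3 x| <= multinom3 R n1 n2 n3 *
    (norm' x ^+ (n1 + n2 + n3) / (n1 + n2 + n3)`!%:R).
Proof.
rewrite /fueter_poly normrZ ger0_norm ?invr_ge0 // mulrA mulrC ler_wpM2r ?invr_ge0 //.
apply: le_trans (ler_norm_sum _ _ _) _.
apply: le_trans (_ : \sum_(w in fueter_words n1 n2 n3) norm' x ^+ (n1 + n2 + n3) <= _).
  by apply: ler_sum => w _; rewrite -[in leRHS](size_tuple w) word_norm_le.
by rewrite sumr_const -mulr_natl ler_wpM2r ?exprn_ge0 ?norm'_ge0 ?card_fueter_words_le.
Qed.

(** The [c_n] whose n-th roots have limsup [fueter_sigma a]. *)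
Definition fueter_weight a n : R :=
  \sum_(n1 < n.+1) \sum_(n2 < n.+1) \sum_(n3 < n.+1 | (n1 + n2 + n3 == n)%N)
    multinom3 R n1 n2 n3 * (`|a n1 n2 n3| / n`!%:R).

Lemma fueter_weight_ge0 a n : 0 <= fueter_weight a n.
Proof.
do 3 (apply: sumr_ge0 => ? _).
by rewrite /multinom3 !(mulr_ge0, divr_ge0).
Qed.

Lemma fueter_term_norm_le a n x :
  `|fueter_term a n x| <= fueter_weight a n * norm' x ^+ n.
Proof.
rewrite /fueter_term /fueter_weight mulr_suml.
do 2 (apply: le_trans (ler_norm_sum _ _ _) _; apply: ler_sum => ? _; rewrite ?mulr_suml).
apply: le_trans (ler_norm_sum _ _ _) _; apply: ler_sum => n3 /eqP nE.
rewrite quat_normM; apply: le_trans (ler_wpM2r _ (fueter_poly_norm_le _ _ _ _)) _ => //.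
by rewrite nE le_eqVlt; apply/orP; left; apply/eqP; set k := (n`!%:R)^-1; ring.
Qed.

(** The limsup is an infimum of suprema over neighbourhoods of infinity; one of these suprema is
    already below [l]. *)
Lemma limn_esup_lt (u : (\bar R)^nat) (l : \bar R) :
  (limn_esup u < l)%E -> \forall n \near \oo, (u n < l)%E.
Proof.
rewrite /limn_esup limf_esupE => /ereal_inf_lt[_ [V FV <-]] Vl.
apply: filterS FV => n Vn; apply: le_lt_trans Vl.
by apply: ereal_sup_ubound; exists n.
Qed.

Lemma fueter_weight_le a (t : R) : 0 < t -> (t%:E < (fueter_sigma a)^-1)%E ->
  \forall n \near \oo, fueter_weight a n * t ^+ n <= 1.
Proof.
move=> t0 ta.
have st : (fueter_sigma a < (t^-1)%:E)%E.
  (* For [s = 0] the inverse is [+oo] and [0 < t] suffices; for [+oo] it is 0, contradicting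
     [0 < t]. *)
  move: ta; case: (fueter_sigma a) => [s| |] /=.
  - rewrite inver; case: eqP => [-> _|_]; first by rewrite lte_fin invr_gt0.
    rewrite !lte_fin => ts; have s0 : 0 < s by rewrite -invr_gt0 (lt_trans t0).
    by rewrite -[s]invrK ltf_pV2 // posrE invr_gt0.
  - by rewrite invey lte_fin ltNge (ltW t0).
  - by rewrite ltNyr.
near=> n.
(* Raising the n-th root to the power [n] gives back [c_n] only for nonzero [n]. *)
have n0 : (0 < n)%N by near: n; exists 1%N.
have : (fueter_weight a n `^ n%:R^-1 < t^-1).
  by rewrite -lte_fin; near: n; exact: limn_esup_lt st.
move=> /ltW /(lerXn2r n); rewrite !nnegrE powR_ge0 invr_ge0 (ltW t0) => /(_ erefl erefl).
rewrite -[X in X <= _]powR_mulrn ?powR_ge0 // -powRrM mulVf ?pnatr_eq0 -?lt0n //.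
rewrite powRr1 ?fueter_weight_ge0 // exprVn -div1r ler_pdivlMr //.
by rewrite exprn_gt0.
Unshelve. all: by end_near. Qed.

(** The right-hand side is exactly [q^(n+1) + ... + q^m], so the induction on [m] adds one term and
    closes by an identity. *)
Lemma fueter_psum_dist_le a (q : R) (N : nat) x : q < 1 ->
  (forall n, (N <= n)%N -> `|fueter_term a n x| <= q ^+ n) ->
  forall n m, (N <= n <= m)%N ->
  `|fueter_psum a m x - fueter_psum a n x| <= geometric (q / (1 - q)) q n -
    geometric (q / (1 - q)) q m.
Proof.
move=> q1 aq n m /andP[Nn]; elim: m => [|m IH].
  by rewrite leqn0 => /eqP ->; rewrite !subrr normr0.
rewrite leq_eqVlt => /predU1P[->|]; first by rewrite !subrr normr0.
rewrite ltnS => nm; rewrite {1}/fueter_psum big_ord_recr /= -/(fueter_psum a m x).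
rewrite addrAC; apply: le_trans (ler_normD _ _) _.
apply: le_trans (lerD (IH nm) (aq m.+1 _)) _; first by rewrite (leq_trans Nn) // leqW.
rewrite /geometric /= le_eqVlt; apply/orP; left; apply/eqP.
have q10 : 1 - q != 0 by rewrite subr_eq0 gt_eqF.
by rewrite exprS; field.
Qed.

End FueterSeries.

(* [inve] satisfies 0^-1 = +oo and +oo^-1 = 0. *)
Theorem theorem3p0p4 (R : realType) (a : nat -> nat -> nat -> quat R) :
  converges_compactly (fueter_psum a) (ball' (fueter_sigma a)^-1%E).
Proof.
exists (fun x => quat_lim ((fueter_psum a)^~ x)) => K cK KU.
(* On an empty [K] there is no maximum to take, but any rate works. *)
have [K0|K0] := pselect (K !=set0); last first.
  apply: (@uniform_cauchy_rate_lim _ _ _ (fun=> 0) 0); first exact: cvg_cst.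
  by move=> x n m Kx; case: K0; exists x.
have [c /set_mem Kc cmax] :=
  compact_EVT_max K0 cK (continuous_subspaceT (@norm'_continuous R)).
(* The midpoint if the radius is finite, [norm' c + 1] if it is infinite. *)
have [t ct ta] : exists2 t : R, norm' c < t & (t%:E < (fueter_sigma a)^-1)%E.
  have := KU _ Kc; rewrite /ball' /=; case: (_^-1)%E => [s| |] //=.
    rewrite lte_fin => cs; exists ((norm' c + s) / 2); first lra.
    by rewrite lte_fin; lra.
  by move=> _; exists (norm' c + 1); [lra|rewrite ltry].
have t0 : 0 < t := le_lt_trans (norm'_ge0 c) ct.
have [N _ aN] := fueter_weight_le t0 ta.
pose q := norm' c / t.
have q0 : 0 <= q by rewrite divr_ge0 ?norm'_ge0 // ltW.
have q1 : q < 1 by rewrite ltr_pdivrMr // mul1r.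
apply: (@uniform_cauchy_rate_lim _ _ _ (geometric (q / (1 - q)) q) N).
  by apply: cvg_geometric; rewrite ger0_norm.
move=> x n m Kx nm; apply: le_trans (fueter_psum_dist_le q1 _ nm) _.
  move=> k Nk; apply: le_trans (fueter_term_norm_le _ _ _) _.
  (* Regrouped as [c_k t^k <= 1] times [norm' x ^ k <= norm' c ^ k]. *)
  rewrite /q expr_div_n ler_pdivlMr ?exprn_gt0 // mulrAC.
  rewrite -[leRHS]mul1r ler_pM //; last first.
  - by rewrite lerXn2r ?nnegrE ?norm'_ge0 // cmax // inE.
  - exact: aN.
  - by rewrite exprn_ge0 ?norm'_ge0.
  - by rewrite mulr_ge0 ?fueter_weight_ge0 ?exprn_ge0 // ltW.
(* Dropping the subtracted term leaves a rate in [n] alone. *)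
by rewrite gerBl mulr_ge0 ?exprn_ge0 // divr_ge0 // subr_ge0 ltW.
Qed.
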